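(* For $d,n\in\mathbb{N}$ satisfying $n\ge2d$, with $\alpha=n/d$, we have $$|B_n^d\cap\mathbb{Z}^d|\approx\mathrm{Vol}(B_n^d)\exp\Big(\frac{d}{12\alpha^2}+O(d/\alpha^3)\Big).$$ In particular, if $n\gtrsim d^{3/2}$ (that is, $n\ge a d^{3/2}$ for a fixed constant $a>0$, the implicit constants in the conclusion then being allowed to depend on $a$), then $$|B_n^d\cap\mathbb{Z}^d|\approx\mathrm{Vol}(B_n^d).$$
   Context: $\mathbb{N}=\{1,2,\dots\}$. $B_n^d=\{x\in\mathbb{R}^d:|x_1|+\dots+|x_d|\le n\}$; $\mathrm{Vol}$ is $d$-dimensional Lebesgue measure and $|A|$ is the cardinality of a finite set $A$. For positive real quantities, $X\lesssim Y$ means $X\le CY$ with a universal constant $C>0$ (independent of $d,n$), and $X\approx Y$ means $X\lesssim Y\lesssim X$. $O(Y)$ denotes a quantity (depending on $d,n$) of absolute value at most $CY$ with $C$ universal. *)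

(* Defs.v *)
From HB Require Import structures.
From mathcomp Require Import all_boot all_order all_algebra finmap.
From mathcomp Require Import all_classical all_reals all_analysis.

Set Implicit Arguments.
Unset Strict Implicit.
Unset Printing Implicit Defensive.

Import Order.TTheory GRing.Theory Num.Theory numFieldNormedType.Exports.

Local Open Scope classical_set_scope.
Local Open Scope ring_scope.

Section tuple_cons.
Context d (T : measurableType d) (n : nat).

Definition tuple_cons (p : T * n.-tuple T) : n.+1.-tuple T :=
  [tuple of p.1 :: p.2].

Lemma measurable_tuple_cons : measurable_fun [set: T * n.-tuple T] tuple_cons.
Proof. exact: measurable_cons. Qed.

Lemma tuple_cons_preimage (A : 'I_n.+1 -> set T) :
  tuple_cons @^-1` [set t | forall i, A i (tnth t i)] =
  A ord0 `*` [set t | forall i, A (lift ord0 i) (tnth t i)].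
Proof.
apply/seteqP; split=> [[x t]/= At|[x t]/= [Ax At] i].
  split=> [|i]; first by have := At ord0; rewrite /tuple_cons/= tnth0.
  by have := At (lift ord0 i); rewrite /tuple_cons/= tnthS.
by case: (unliftP ord0 i) => [j|] ->; rewrite /tuple_cons/= ?tnthS ?tnth0.
Qed.

End tuple_cons.

Lemma measurable_box d (T : measurableType d) (n : nat) (A : 'I_n -> set T) :
  (forall i, measurable (A i)) ->
  measurable [set t : n.-tuple T | forall i, A i (tnth t i)].
Proof.
move=> mA.
rewrite (_ : [set _ | _] = \bigcap_(i in [set: 'I_n]) ((@tnth n T ^~ i) @^-1` A i)).
  apply: fin_bigcap_measurable => // i _.
  by rewrite -[X in measurable X]setTI; exact: measurable_tnth.
by apply/seteqP; split=> [t At i _|t At i]; [exact: At|exact: (At i I)].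
Qed.

Section product_measure_cons.
Local Open Scope ereal_scope.
Context d (T : measurableType d) (R : realType) (n : nat).
Variable m : {sigma_finite_measure set T -> \bar R}.
Variable mu : {sigma_finite_measure set (n.-tuple T) -> \bar R}.

Definition product_measure_cons : set (n.+1.-tuple T) -> \bar R :=
  pushforward (m \x mu) (@tuple_cons d T n).

Let product_measure_cons0 : product_measure_cons set0 = 0.
Proof. by rewrite /product_measure_cons /pushforward preimage_set0 measure0. Qed.

Let product_measure_cons_ge0 A : 0 <= product_measure_cons A.
Proof. by rewrite /product_measure_cons /pushforward measure_ge0. Qed.

Let product_measure_cons_sigma_additive :
  semi_sigma_additive product_measure_cons.
Proof.
move=> F mF tF mUF; rewrite /product_measure_cons /pushforward preimage_bigcup.
have mcF A : measurable A -> measurable (@tuple_cons d T n @^-1` A).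
  by move=> mA; rewrite -[X in measurable X]setTI; exact: measurable_tuple_cons.
apply: measure_semi_sigma_additive => [k||].
- exact: mcF.
- apply/trivIsetP => /= i j _ _ ij; rewrite -preimage_setI.
  by move/trivIsetP : tF => /(_ _ _ _ _ ij) ->//; rewrite preimage_set0.
- by rewrite -preimage_bigcup; exact: mcF.
Qed.

HB.instance Definition _ := isMeasure.Build _ _ _ product_measure_cons
  product_measure_cons0 product_measure_cons_ge0
  product_measure_cons_sigma_additive.

Lemma product_measure_consX (A : set T) (B : set (n.-tuple T)) :
  measurable A -> measurable B ->
  product_measure_cons [set t | A (thead t) /\ B [tuple of behead t]] =
  m A * mu B.
Proof.
move=> mA mB; rewrite -product_measure1E// /product_measure_cons /pushforward.
congr (_ \x _); apply/seteqP.
have consK x (t : n.-tuple T) : [tuple of behead (tuple_cons (x, t))] = t.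
  exact/val_inj.
by split=> -[x t] /=; rewrite consK theadE.
Qed.

Let product_measure_cons_sigma_finite : sigma_finite setT product_measure_cons.
Proof.
have /sigma_finiteP[F [TF ndF Foo]] := sigma_finiteT m.
have /sigma_finiteP[G [TG ndG Goo]] := sigma_finiteT mu.
exists (fun k => [set t | F k (thead t) /\ G k [tuple of behead t]]).
  apply/seteqP; split=> // t _.
  have [i _ Fi] : (\bigcup_k F k) (thead t) by rewrite -TF.
  have [j _ Gj] : (\bigcup_k G k) [tuple of behead t] by rewrite -TG.
  exists (maxn i j) => //; split.
    by move: Fi; apply/subsetPset/ndF/leq_maxl.
  by move: Gj; apply/subsetPset/ndG/leq_maxr.
move=> k; have [mF Fk] := Foo k; have [mG Gk] := Goo k; split.
  apply: measurableI; rewrite -[X in measurable X]setTI.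
    exact: measurable_tnth.
  exact: measurable_behead.
by rewrite product_measure_consX// lte_mul_pinfty// ge0_fin_numE.
Qed.

HB.instance Definition _ := Measure_isSigmaFinite.Build _ _ _
  product_measure_cons product_measure_cons_sigma_finite.

End product_measure_cons.

(* The n-fold product of m: the empty product is the unit mass at the empty
   tuple; it is characterised by product_measure_tuple_box below. *)
Fixpoint product_measure_tuple d (T : measurableType d) (R : realType)
    (m : {sigma_finite_measure set T -> \bar R}) (n : nat) :
    {sigma_finite_measure set (n.-tuple T) -> \bar R} :=
  if n is n'.+1 then product_measure_cons m (product_measure_tuple m n')
  else dirac [tuple].

Lemma product_measure_tuple_box d (T : measurableType d) (R : realType)
    (m : {sigma_finite_measure set T -> \bar R}) (n : nat)
    (A : 'I_n -> set T) :
  (forall i, measurable (A i)) ->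
  product_measure_tuple m n [set t | forall i, A i (tnth t i)] =
  (\prod_(i < n) m (A i))%E.
Proof.
elim: n A => [|n IHn] A mA.
  by rewrite big_ord0 /= diracE mem_set // => -[].
rewrite big_ord_recl -IHn => [|i]; last exact: mA.
rewrite -product_measure_consX//; last first.
  exact: (@measurable_box _ _ _ (fun i => A (lift ord0 i))).
congr (product_measure_cons m (product_measure_tuple m n) _)%E.
apply/seteqP; split=> t /= At.
  split=> [|i]; first exact: At.
  rewrite tnth_behead (_ : inord _ = lift ord0 i)//.
  by apply/val_inj; rewrite /= inordK// ltnS.
move=> i; case: At => A0 At; case: (unliftP ord0 i) => [j ->|->] //.
rewrite (_ : tnth t _ = tnth [tuple of behead t] j)//.
by rewrite tnth_behead; congr tnth; apply/val_inj; rewrite /= inordK// ltnS.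
Qed.

Definition lebesgue_tuple (R : realType) (d : nat) :
    {sigma_finite_measure set (d.-tuple (measurableTypeR R)) -> \bar R} :=
  product_measure_tuple (@lebesgue_measure R) d.

(* measurableTypeR R is R with its Borel sigma-algebra; the annotations : R
   below only recover the algebraic structure of R. *)
Definition l1_ball (R : realType) (d n : nat) :
    set (d.-tuple (measurableTypeR R)) :=
  [set x | \sum_(i < d) `|tnth x i : R| <= n%:R].

Definition int_lattice (R : realType) (d : nat) :
    set (d.-tuple (measurableTypeR R)) :=
  [set x | forall i, (tnth x i : R) \is a Num.int].

Lemma finite_l1_ball_int_lattice (R : realType) (d n : nat) :
  finite_set (@l1_ball R d n `&` @int_lattice R d).
Proof.
pose F (f : {ffun 'I_d -> 'I_(n + n).+1}) : d.-tuple (measurableTypeR R) :=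
  [tuple ((f i)%:R - n%:R : R) | i < d].
apply: (@sub_finite_set _ _ (F @` setT)); last first.
  by apply: finite_image; exact: finite_finset.
move=> x [/= xn xint].
exists [ffun i => inord (absz (Num.floor (tnth x i : R) + n%:Z))] => //.
apply: eq_from_tnth => i; rewrite tnth_mktuple ffunE.
have [k xk] := intrP (xint i).
have : `|tnth x i : R| <= n%:R.
  apply: le_trans xn; rewrite (bigD1 i)//= lerDl.
  by apply: sumr_ge0 => j _.
rewrite xk intrKfloor -intr_norm (pmulrn 1 n) ler_int ler_norml => /andP[k1 k2].
have kn : 0 <= k + n%:Z by rewrite -lerBlDr sub0r.
rewrite inordK; last by rewrite ltnS -lez_nat gez0_abs// PoszD lerD2r.
by rewrite natr_absz ger0_norm// rmorphD/= -pmulrn addrK.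
Qed.

Lemma measurable_l1_ball (R : realType) (d n : nat) :
  measurable (@l1_ball R d n).
Proof.
have mf : measurable_fun [set: d.-tuple (measurableTypeR R)]
    (fun x => \sum_(i < d) `|tnth x i : R|).
  apply: measurable_sum => i; apply: measurableT_comp => //.
  exact: measurable_tnth.
rewrite -[X in measurable X]setTI.
rewrite (_ : l1_ball n =
  (fun x => \sum_(i < d) `|tnth x i : R|) @^-1` `]-oo, n%:R]%classic).
  exact: mf.
by apply/seteqP; split=> x /=; rewrite in_itv.
Qed.

Lemma fin_num_lebesgue_l1_ball (R : realType) (d n : nat) :
  lebesgue_tuple R d (@l1_ball R d n) \is a fin_num.
Proof.
pose I (i : 'I_d) : set (measurableTypeR R) := `[- n%:R, n%:R]%classic.
have mI i : measurable (I i) by exact: measurable_itv.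
have sub : @l1_ball R d n `<=` [set x | forall i, I i (tnth x i)].
  move=> x xn i; rewrite /I /= in_itv/= -ler_norml.
  by apply: le_trans xn; rewrite (bigD1 i)//= lerDl sumr_ge0.
rewrite ge0_fin_numE//; apply: (@le_lt_trans _ _
    (lebesgue_tuple R d [set x | forall i, I i (tnth x i)])).
  by apply: le_measure => //; rewrite inE;
    [exact: measurable_l1_ball|exact: measurable_box].
rewrite product_measure_tuple_box// -ge0_fin_numE; last exact: prode_ge0.
apply: prode_fin_num => i _.
by rewrite /I /= lebesgue_measure_itv; case: ifPn.
Qed.

(* X <~ Y, X ~ Y and X = O(Y), with one constant for all (d, n) in D. *)
Section uniform_comparison.
Context (R : realType).
Implicit Types (D : nat -> nat -> Prop) (X Y : nat -> nat -> R).

Definition uniform_lesssim D X Y : Prop :=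
  exists2 C : R, 0 < C & forall d n, D d n -> X d n <= C * Y d n.

Definition uniform_approx D X Y : Prop := uniform_lesssim D X Y /\ uniform_lesssim D Y X.

Definition uniform_bigO D X Y : Prop := uniform_lesssim D (fun d n => `|X d n|) Y.

End uniform_comparison.

Section ball_counts.
Context (R : realType).
Implicit Types d n : nat.

(* fset_set and fine have junk values on infinite sets and at +oo; neither is
   met here: see finite_l1_ball_int_lattice and fin_num_lebesgue_l1_ball. *)
Definition lattice_count d n : R :=
  #|` fset_set (@l1_ball R d n `&` @int_lattice R d)|%:R.

Definition ball_vol d n : R := fine (lebesgue_tuple R d (@l1_ball R d n)).

Definition alpha d n : R := n%:R / d%:R.

End ball_counts.

Definition admissible (d n : nat) : Prop :=
  [/\ (0 < d)%N, (0 < n)%N & (2 * d <= n)%N].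

(* Main.v *)
Require Import Defs.
From mathcomp Require Import all_boot all_order all_algebra finmap.
From mathcomp Require Import all_classical all_reals all_analysis.
From mathcomp Require Import measurable_realfun ring lra zify.

Set Implicit Arguments.
Unset Strict Implicit.
Unset Printing Implicit Defensive.

Import Order.TTheory GRing.Theory Num.Theory.

Local Open Scope ring_scope.

(* The volume is (2n)^d/d!, and the lattice count is
   sum_j C(d,j) C(n+d-j,d), since both sides obey the Delannoy recurrence.
   Dividing, the quotient is the binomial average over J ~ B(d,1/2) of
   prod_(1 <= i <= d) (1 + (i - J)/n).  Put s = d/n <= 1/2 and
   W = (d+1)/2 - J.  Every factor is 1 + x with |x| <= s, so replacing
   ln (1 + x) by x - x^2/2 costs O(d s^3) = O(d/alpha^3) in total, and the
   product becomes exp (s W - s^2 W^2/(2d) - s^2 (d^2-1)/(24 d)).  The average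
   of exp (s W) is e^(s/2) cosh(s/2)^d = exp (d s^2/8 + O(1 + d s^3)), and
   d s^2/8 - d s^2/24 = d/(12 alpha^2).  The W^2 term is dropped in the upper
   bound; in the lower bound Jensen's inequality under the tilted binomial law
   shows that it costs only O(1 + d s^3). *)

(** * Taylor estimates *)

Section taylor.
Import numFieldNormedType.Exports.
Local Open Scope classical_set_scope.
Local Open Scope ring_scope.
Context {R : realType}.
Implicit Types x y : R.

(** The mean value theorem between 0 and x, with the derivative bounded by [2 * x ^+ 2] throughout;
    the factor 3 that integration would gain is given up. *)
Lemma cube_bound_of_derivative (f df : R -> R) (h x : R) :
  f 0 = 0 -> (forall y, `|y| <= h -> is_derive y 1 f (df y)) ->
  (forall y, `|y| <= h -> `|df y| <= 2 * y ^+ 2) ->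
  `|x| <= h -> `|f x| <= 2 * `|x| ^+ 3.
Proof.
move=> f0 fdf dfb xh.
have mvt a b : a <= b -> (forall y, a <= y <= b -> `|y| <= `|x|) ->
    `|f b - f a| <= 2 * `|x| ^+ 2 * (b - a).
  move=> ab yx.
  have fD y : y \in `[a, b] -> is_derive y 1 f (df y).
    by rewrite in_itv/= => /yx yb; apply: fdf; exact: le_trans xh.
  have cf : {within `[a, b], continuous f}.
    by apply: derivable_within_continuous => y /fD dfy; exact: ex_derive.
  have fD' y : y \in `]a, b[ -> is_derive y 1 f (df y).
    by move=> yab; apply: fD; exact: subset_itv_oo_cc yab.
  have [y yab ->] := MVT_segment ab fD' cf.
  have yb : `|y| <= `|x| by apply: yx; move: yab; rewrite in_itv.
  rewrite normrM (ger0_norm (_ : 0 <= b - a)) ?subr_ge0//.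
  apply: ler_wpM2r; first by rewrite subr_ge0.
  apply: le_trans (dfb _ (le_trans yb xh)) _.
  by rewrite ler_pM2l// -(real_normK (num_real y)) lerXn2r// nnegrE.
rewrite exprSr mulrA; have [x0|x0] := leP 0 x.
  have := mvt 0 x x0; rewrite f0 !subr0 => /(_ _)/le_trans; apply.
    by move=> y /andP[y0 yx]; rewrite !ger0_norm.
  by rewrite (ger0_norm x0).
have := mvt x 0 (ltW x0); rewrite f0 !sub0r normrN => /(_ _)/le_trans; apply.
  by move=> y /andP[xy y0]; rewrite ler0_norm// ltr0_norm// lerN2.
by rewrite (ltr0_norm x0).
Qed.

(** The remainder has derivative [y^2 / (1 + y)], and [1 + y >= 1/2] on the range considered. *)
Lemma ln1D_taylor2 x : `|x| <= 2^-1 ->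
  `|ln (1 + x) - (x - x ^+ 2 / 2)| <= 2 * `|x| ^+ 3.
Proof.
apply: (@cube_bound_of_derivative (fun y => ln (1 + y) - (y - y ^+ 2 / 2))
   (fun y => y ^+ 2 / (1 + y))).
- by rewrite addr0 ln1 expr0n/= mul0r !subr0.
- move=> y yh.
  have y1 : 0 < 1 + y by move: yh; rewrite ler_norml; lra.
  have dln := is_derive1_ln y1.
  apply: is_derive_eq.
  rewrite /GRing.scale/=; field.
  lra.
- move=> y; rewrite ler_norml => yh.
  have y1 : 0 < 1 + y by lra.
  rewrite ger0_norm; last by rewrite divr_ge0 ?sqr_ge0 ?ltW.
  rewrite ler_pdivrMr//; nra.
Qed.

(** The upper half comes from [e^(-x) >= 1 - x]: then [e^x <= 1/(1 - x) = 1 + x + x^2/(1 - x)], with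
    [1 - x >= 1/2]. *)
Lemma expR_taylor1 x : `|x| <= 2^-1 -> `|expR x - 1 - x| <= 2 * x ^+ 2.
Proof.
rewrite ler_norml => xh.
have e1 := expR_ge1Dx x; have e2 := expR_ge1Dx (- x).
have e3 := expRxMexpNx_1 x; have := expR_gt0 x.
by rewrite ger0_norm; nra.
Qed.

Lemma expR_taylor2 x : `|x| <= 2^-1 ->
  `|expR x - 1 - x - x ^+ 2 / 2| <= 2 * `|x| ^+ 3.
Proof.
apply: (@cube_bound_of_derivative (fun y => expR y - 1 - y - y ^+ 2 / 2)
   (fun y => expR y - 1 - y)).
- by rewrite expR0 expr0n/= mul0r !subr0 subrr.
- by move=> y _; apply: is_derive_eq; rewrite /GRing.scale/=; field.
- by move=> y; exact: expR_taylor1.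
Qed.

(** Averaging the expansions at x and -x cancels the odd terms. A cubic error suffices: at x = s/2
    the d-th power turns it into O(d s^3). *)
Lemma cosh_le x : 0 <= x <= 2^-1 ->
  (expR x + expR (- x)) / 2 <= expR (x ^+ 2 / 2 + 2 * x ^+ 3).
Proof.
move=> /andP[x0 xh]; have xh' : `|x| <= 2^-1 by rewrite ger0_norm.
have := expR_taylor2 xh'; have : `|- x| <= 2^-1 by rewrite normrN.
move/expR_taylor2; rewrite normrN sqrrN (ger0_norm x0) !ler_norml.
have := expR_ge1Dx (x ^+ 2 / 2 + 2 * x ^+ 3); lra.
Qed.

(** The average is at least 1 + v with v = x^2/2 - 2 x^3, nonnegative because x <= 1/4. Then 1 + v
    >= exp (v - v^2) and v^2 <= x^3, whence the constant 3. *)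
Lemma cosh_ge x : 0 <= x <= 4^-1 ->
  expR (x ^+ 2 / 2 - 3 * x ^+ 3) <= (expR x + expR (- x)) / 2.
Proof.
move=> /andP[x0 xh]; have xh' : `|x| <= 2^-1 by rewrite ger0_norm//; lra.
have := expR_taylor2 xh'; have : `|- x| <= 2^-1 by rewrite normrN.
move/expR_taylor2; rewrite normrN sqrrN (ger0_norm x0) !ler_norml => e1 e2.
set v := x ^+ 2 / 2 - 2 * x ^+ 3.
have v0 : 0 <= v by rewrite /v; nra.
have vx : v <= x ^+ 2 / 2 by rewrite /v lerBlDr lerDl mulr_ge0// exprn_ge0.
have vv : v ^+ 2 <= x ^+ 3.
  apply: (@le_trans _ _ ((x ^+ 2 / 2) ^+ 2)); first by rewrite lerXn2r// nnegrE; nra.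
  rewrite expr_div_n -exprM (_ : x ^+ (2 * 2) = x * x ^+ 3); last by rewrite -exprS.
  have := exprn_ge0 3 x0; nra.
apply: (@le_trans _ _ (1 + v)); last by rewrite /v; lra.
apply: (@le_trans _ _ (expR (v - v ^+ 2))).
  by rewrite ler_expR; move: (erefl v) vv; rewrite {1}/v; lra.
have e3 := expR_ge1Dx (v ^+ 2 - v).
have := expRxMexpNx_1 (v - v ^+ 2); rewrite opprB => eN.
have w0 : 0 < 1 + (v ^+ 2 - v) by nra.
rewrite -(ler_pM2r w0); apply: (@le_trans _ _ 1); last first.
  (* [(1 + v) (1 - v + v^2) = 1 + v^3]. *)
  by have := exprn_ge0 3 v0; nra.
by rewrite -[leRHS]eN; apply: ler_wpM2l e3; exact: expR_ge0.
Qed.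

End taylor.

(** * Binomial averages *)

Section binomial_sums.
Context {R : comNzRingType}.
Implicit Types (p q : R) (d : nat) (f : nat -> R).

(** A binomial average left unnormalised, of total mass [(p + q) ^+ d]. With free weights,
    exponential tilting is a mere change of p and q. *)
Definition binomial_sum p q d f :=
  \sum_(j < d.+1) 'C(d, j)%:R * p ^+ (d - j) * q ^+ j * f j.

Lemma eq_binomial_sum p q d f g : (forall j, f j = g j) ->
  binomial_sum p q d f = binomial_sum p q d g.
Proof. by move=> fg; apply: eq_bigr => j _; rewrite fg. Qed.

Lemma binomial_sumD p q d f g :
  binomial_sum p q d (fun j => f j + g j) =
  binomial_sum p q d f + binomial_sum p q d g.
Proof. by rewrite -big_split; apply: eq_bigr => j _; rewrite mulrDr. Qed.

Lemma binomial_sumZ p q d f c :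
  binomial_sum p q d (fun j => c * f j) = c * binomial_sum p q d f.
Proof. by rewrite mulr_sumr; apply: eq_bigr => j _; rewrite mulrCA. Qed.

Lemma binomial_sum0 p q f : binomial_sum p q 0 f = f 0%N.
Proof. by rewrite /binomial_sum big_ord1/= !mul1r. Qed.

(** Pascal's rule, read as conditioning on one trial. It drives the inductions for the moments and
    for the lattice count. *)
Lemma binomial_sumS p q d f :
  binomial_sum p q d.+1 f =
  p * binomial_sum p q d f + q * binomial_sum p q d (fun j => f j.+1).
Proof.
rewrite !mulr_sumr.
transitivity (\sum_(j < d.+2) ('C(d, j)%:R * p ^+ (d.+1 - j) * q ^+ j * f j)
  + \sum_(j < d.+1) ('C(d, j)%:R * p ^+ (d - j) * q ^+ j.+1 * f j.+1)).
  rewrite [LHS]big_ord_recl [in RHS]big_ord_recl -addrA !bin0; congr +%R.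
  rewrite -big_split/=; apply: eq_bigr => j _.
  by rewrite /bump/= add1n binS natrD subSS; ring.
rewrite big_ord_recr/= bin_small// !mul0r addr0; congr +%R.
  apply: eq_bigr => j _; rewrite subSn; last by rewrite -ltnS.
  by rewrite exprS; ring.
by apply: eq_bigr => j _; rewrite exprS; ring.
Qed.

Lemma binomial_moment0 p q d : binomial_sum p q d (fun=> 1) = (p + q) ^+ d.
Proof.
by rewrite exprDn; apply: eq_bigr => j _; rewrite mulr1 -mulrA mulr_natl.
Qed.

Let centeredS d j : d.+1%:R - 2 * j%:R = (d%:R - 2 * j%:R) + 1 :> R.
Proof. by rewrite -natr1; ring. Qed.

Let centeredSS d j : d.+1%:R - 2 * j.+1%:R = (d%:R - 2 * j%:R) + (-1) * 1 :> R.
Proof. by rewrite -!natr1; ring. Qed.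

(** d - 2J is a sum of d independent signs, +1 with weight p and -1 with weight q, of mean d (p -
    q)/(p + q). Denominators are cleared so that the identity makes sense in a ring. *)
Lemma binomial_moment1 p q d :
  binomial_sum p q d (fun j => d%:R - 2 * j%:R) * (p + q) =
  d%:R * (p - q) * (p + q) ^+ d.
Proof.
elim: d => [|d IH]; first by rewrite binomial_sum0; ring.
rewrite binomial_sumS (eq_binomial_sum _ _ _ (centeredS d)).
rewrite (eq_binomial_sum _ _ _ (centeredSS d)).
set M1 := binomial_sum _ _ _ _ in IH *; rewrite binomial_sumD -/M1.
rewrite binomial_sumD -/M1 binomial_sumZ binomial_moment0 -natr1 exprS.
transitivity ((p + q) * (M1 * (p + q)) + (p - q) * (p + q) * (p + q) ^+ d).
  by ring.
by rewrite IH; ring.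
Qed.

(** Variance 4 d p q/(p + q)^2 plus squared mean, cleared of denominators. *)
Lemma binomial_moment2 p q d :
  binomial_sum p q d (fun j => (d%:R - 2 * j%:R) ^+ 2) * (p + q) ^+ 2 =
  (4 * d%:R * p * q + d%:R ^+ 2 * (p - q) ^+ 2) * (p + q) ^+ d.
Proof.
elim: d => [|d IH]; first by rewrite binomial_sum0; ring.
rewrite binomial_sumS.
under [X in p * X]eq_binomial_sum => j.
  rewrite (_ : _ ^+ 2 = (d%:R - 2 * j%:R) ^+ 2 + (2 * (d%:R - 2 * j%:R) + 1)).
    over.
  by rewrite centeredS; ring.
under [X in q * X]eq_binomial_sum => j.
  rewrite (_ : _ ^+ 2 = (d%:R - 2 * j%:R) ^+ 2 + ((-2) * (d%:R - 2 * j%:R) + 1)).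
    over.
  by rewrite centeredSS; ring.
set M2 := binomial_sum _ _ _ _ in IH *.
set M1 := binomial_sum p q d (fun j => d%:R - 2 * j%:R).
rewrite binomial_sumD -/M2 binomial_sumD binomial_sumZ -/M1.
rewrite binomial_sumD -/M2 binomial_sumD binomial_sumZ -/M1 binomial_moment0.
have M1E : M1 * (p + q) = d%:R * (p - q) * (p + q) ^+ d by exact: binomial_moment1.
transitivity ((p + q) * (M2 * (p + q) ^+ 2) +
  2 * (p - q) * (p + q) * (M1 * (p + q)) + (p + q) ^+ 3 * (p + q) ^+ d).
  by ring.
by rewrite IH M1E -(natr1 d) (exprS _ d); ring.
Qed.

End binomial_sums.

Section shifted_sums.
Context {R : numFieldType}.

Lemma sum_shifted (d : nat) (c : R) :
  \sum_(i < d) (i.+1%:R - c) = d%:R * ((d%:R + 1) / 2 - c).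
Proof.
elim: d => [|d IH]; first by rewrite big_ord0 mul0r.
by rewrite big_ord_recr/= IH -natr1; field.
Qed.

(** The term d (d^2 - 1)/12 is the sum of squares of 1, ..., d about their mean (d + 1)/2; the other
    term is the shift from the mean to c. *)
Lemma sum_shifted_sqr (d : nat) (c : R) :
  \sum_(i < d) (i.+1%:R - c) ^+ 2 =
  d%:R * ((d%:R + 1) / 2 - c) ^+ 2 + d%:R * (d%:R ^+ 2 - 1) / 12.
Proof.
elim: d => [|d IH]; first by rewrite big_ord0 !mul0r addr0.
by rewrite big_ord_recr/= IH -natr1; field.
Qed.

End shifted_sums.

(** * Two-sided bounds for the quotient of lattice count by volume *)

Section ratio.
Context {R : realType}.

Lemma le_binomial_sum (p q : R) d f g : 0 <= p -> 0 <= q ->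
  (forall j, (j <= d)%N -> f j <= g j) ->
  binomial_sum p q d f <= binomial_sum p q d g.
Proof.
move=> p0 q0 fg; apply: ler_sum => j _; apply: ler_wpM2l; last by rewrite fg// -ltnS.
by rewrite !mulr_ge0// exprn_ge0.
Qed.

(** s ((d + 1)/2 - j) = s/2 + (d - j) s/2 - j s/2, so each trial absorbs a factor e^(s/2) or
    e^(-s/2). *)
Lemma binomial_sum_tilt (s : R) d g :
  binomial_sum 1 1 d (fun j => expR (s * ((d%:R + 1) / 2 - j%:R)) * g j) =
  expR (s / 2) * binomial_sum (expR (s / 2)) (expR (- (s / 2))) d g.
Proof.
rewrite mulr_sumr; apply: eq_bigr => j _.
rewrite !expr1n !mulr1 -!expRM_natl natrB; last by rewrite -ltnS.
rewrite (_ : s * _ = s / 2 + ((d%:R - j%:R) * (s / 2) + j%:R * - (s / 2))).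
  by rewrite !expRD; ring.
by field.
Qed.

(** Since i + 1 and j both lie in [0, d], every factor is 1 + x with |x| <= d h <= 1/2. [A] is the
    sum of the x - x^2/2, and each of the d logarithms errs by at most 2 (d h)^3. *)
Lemma prod_shifted_bounds (d j : nat) (h W A : R) :
  (j <= d)%N -> 0 <= h -> d%:R * h <= 2^-1 ->
  W = (d%:R + 1) / 2 - j%:R ->
  A = d%:R * h * W -
      h ^+ 2 / 2 * (d%:R * W ^+ 2 + d%:R * (d%:R ^+ 2 - 1) / 12) ->
  expR (A - 2 * d%:R * (d%:R * h) ^+ 3) <=
    \prod_(i < d) (1 + (i.+1%:R - j%:R) * h) <=
    expR (A + 2 * d%:R * (d%:R * h) ^+ 3).
Proof.
move=> jd h0 dh WE AE0.
pose x (i : 'I_d) : R := (i.+1%:R - j%:R) * h.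
have xs i : `|x i| <= d%:R * h.
  rewrite normrM (ger0_norm h0) ler_wpM2r// ler_norml.
  have : i.+1%:R <= d%:R :> R by rewrite ler_nat.
  have : 0 <= i.+1%:R :> R by rewrite ler0n.
  have : j%:R <= d%:R :> R by rewrite ler_nat.
  have : 0 <= j%:R :> R by rewrite ler0n.
  lra.
have -> : \prod_(i < d) (1 + (i.+1%:R - j%:R) * h) =
    expR (\sum_(i < d) ln (1 + x i)).
  rewrite expR_sum; apply: eq_bigr => i _; rewrite lnK// posrE -/(x i).
  by have := xs i; rewrite ler_norml; lra.
have AE : A = \sum_(i < d) (x i - x i ^+ 2 / 2).
  rewrite sumrB -mulr_suml -[X in X * h]/(\sum_(i < d) (i.+1%:R - j%:R)).
  under [X in _ - X]eq_bigr do rewrite exprMn -mulrA.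
  rewrite -mulr_suml sum_shifted sum_shifted_sqr AE0 WE; ring.
rewrite !ler_expR -ler_distl AE -sumrB.
apply: le_trans (ler_norm_sum _ _ _) _.
rewrite (_ : 2 * _ * _ = \sum_(i < d) 2 * (d%:R * h) ^+ 3); last first.
  by rewrite sumr_const card_ord -mulr_natl; ring.
apply: ler_sum => i _; apply: le_trans (ln1D_taylor2 (le_trans (xs i) dh)) _.
by rewrite ler_pM2l// lerXn2r// ?nnegrE// mulr_ge0.
Qed.

(** At h = 1/n this is the lattice count divided by the volume, by [size_int_ball_ratio] and
    [ball_volE]. *)
Definition ratio d (h : R) : R :=
  2^-1 ^+ d *
  binomial_sum 1 1 d (fun j => \prod_(i < d) (1 + (i.+1%:R - j%:R) * h)).

Lemma ratio_le d (h : R) : (0 < d)%N -> 0 <= h -> d%:R * h <= 2^-1 ->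
  ratio d h <=
    expR (d%:R * (d%:R * h) ^+ 2 / 12 + 4 * (d%:R * (d%:R * h) ^+ 3) + 1).
Proof.
move=> d0 h0 dh; set s := d%:R * h; set th := d%:R * s ^+ 3.
have d1 : 1 <= d%:R :> R by rewrite ler1n.
have s0 : 0 <= s by rewrite mulr_ge0.
have hs : h <= s by rewrite /s; nra.
have th0 : 0 <= th by rewrite mulr_ge0 ?exprn_ge0.
(* The part of the upper bound that does not depend on j. *)
pose K := expR (2 * th - h ^+ 2 / 2 * (d%:R * (d%:R ^+ 2 - 1) / 12)).
have le1 : binomial_sum 1 1 d (fun j => \prod_(i < d) (1 + (i.+1%:R - j%:R) * h)) <=
    binomial_sum 1 1 d (fun j => expR (s * ((d%:R + 1) / 2 - j%:R)) * K).
  apply: le_binomial_sum => // j jd.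
  have /andP[_ /le_trans] := prod_shifted_bounds jd h0 dh erefl erefl; apply.
  rewrite -expRD ler_expR -/s -/th.
  (* The W^2 term enters the exponent with a minus sign, so the upper bound may drop it. *)
  have : 0 <= h ^+ 2 / 2 * (d%:R * ((d%:R + 1) / 2 - j%:R) ^+ 2).
    by apply: mulr_ge0; [rewrite divr_ge0 ?sqr_ge0|apply: mulr_ge0; rewrite ?sqr_ge0].
  by rewrite /th; lra.
have sh : 0 <= s / 2 <= 2^-1 by rewrite /s in s0 *; lra.
rewrite /ratio; apply: le_trans (ler_wpM2l _ le1) _; first by rewrite exprn_ge0.
rewrite binomial_sum_tilt.
have -> p q : binomial_sum p q d (fun=> K) = K * (p + q) ^+ d.
  rewrite -binomial_moment0 -binomial_sumZ; apply: eq_binomial_sum => j.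
  by rewrite mulr1.
rewrite (_ : 2^-1 ^+ d * _ = expR (s / 2) * K *
    ((expR (s / 2) + expR (- (s / 2))) / 2) ^+ d); last by rewrite exprMn; ring.
have := cosh_le sh => ch.
apply: (@le_trans _ _ (expR (s / 2) * K *
    expR ((s / 2) ^+ 2 / 2 + 2 * (s / 2) ^+ 3) ^+ d)).
  apply: ler_wpM2l; first by rewrite mulr_ge0 ?expR_ge0.
  rewrite lerXn2r// nnegrE ?expR_ge0// mulr_ge0// addr_ge0 ?expR_ge0.
rewrite -expRM_natl -!expRD ler_expR.
have -> : h ^+ 2 / 2 * (d%:R * (d%:R ^+ 2 - 1) / 12) =
    d%:R * s ^+ 2 / 24 - s * h / 24.
  by rewrite /s; field.
have -> : d%:R * ((s / 2) ^+ 2 / 2 + 2 * (s / 2) ^+ 3) = d%:R * s ^+ 2 / 8 + th / 4.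
  by rewrite /th; field.
(* The leftovers s/2 and s h/24 are absorbed by the constant 1, and 2 + 1/4 copies of [th] by the
   4. *)
have : s * h <= 1 by move: dh; rewrite -/s; nra.
move: dh; rewrite -/s; lra.
Qed.

(** Under the tilted law d - 2J has variance at most d, as 4 p q <= (p + q)^2, and mean d tanh(s/2)
    <= d s. *)
Lemma tilted_moment2_le (s p q : R) d : 0 <= s <= 2^-1 ->
  p = expR (s / 2) -> q = expR (- (s / 2)) ->
  binomial_sum p q d (fun j => (d%:R - 2 * j%:R) ^+ 2) <=
  (d%:R + d%:R ^+ 2 * s ^+ 2) * (p + q) ^+ d.
Proof.
move=> /andP[s0 sh] pE qE.
have pq1 : p * q = 1 by rewrite pE qE expRxMexpNx_1.
have p1 : 1 <= p by rewrite pE -[leLHS]expR0 ler_expR; lra.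
have q0 : 0 < q by rewrite qE expR_gt0.
have ppE : p ^+ 2 = expR s by rewrite pE -expRM_natl; congr expR; field.
have pp : p ^+ 2 <= 1 + s + 2 * s ^+ 2.
  have := @expR_taylor1 _ s; rewrite ger0_norm// => /(_ sh).
  by rewrite ppE ler_norml; lra.
(* Multiplied by p, with p q = 1, this reads e^s - 1 <= s (e^s + 1), which the first-order expansion
   of e^s gives. *)
have tanh_le : p - q <= s * (p + q).
  rewrite -(ler_pM2l (lt_le_trans ltr01 p1)).
  by rewrite mulrBr mulrCA mulrDr pq1 -expr2; nra.
have pq : q <= p by rewrite pE qE ler_expR; lra.
have p0 : 0 < p by exact: lt_le_trans p1.
have u0 : 0 < (p + q) ^+ 2 by rewrite exprn_gt0// addr_gt0.
rewrite -(ler_pM2r u0) binomial_moment2 -[leRHS]mulrAC.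
apply: ler_wpM2r; first by rewrite exprn_ge0// addr_ge0// ltW.
have sq : (p - q) ^+ 2 <= (s * (p + q)) ^+ 2.
  by rewrite lerXn2r// nnegrE ?subr_ge0// mulr_ge0// addr_ge0// ltW.
rewrite [leRHS]mulrDl -[X in _ <= _ + X]mulrA -[in leRHS]exprMn; apply: lerD.
  2: by rewrite ler_wpM2l ?sqr_ge0.
rewrite (_ : 4 * _ * _ * _ = d%:R * (4 * (p * q))); last by ring.
by rewrite ler_wpM2l//; have := sqr_ge0 (p - q); lra.
Qed.

Lemma ratio_ge d (h : R) : (0 < d)%N -> 0 <= h -> d%:R * h <= 2^-1 ->
  expR (d%:R * (d%:R * h) ^+ 2 / 12 - 4 * (d%:R * (d%:R * h) ^+ 3) - 1) <=
  ratio d h.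
Proof.
move=> d0 h0 dh; set s := d%:R * h; set th := d%:R * s ^+ 3.
have d1 : 1 <= d%:R :> R by rewrite ler1n.
have s0 : 0 <= s by rewrite mulr_ge0.
have sh : s <= 2^-1 by [].
have hs : h <= s by rewrite /s; nra.
have th0 : 0 <= th by rewrite mulr_ge0 ?exprn_ge0.
pose y j := h ^+ 2 / 2 * (d%:R * ((d%:R + 1) / 2 - j%:R) ^+ 2).
(* Jensen by the tangent line: expR (m - y) >= 1 + m - y, and m dominates the
   mean of y under the tilted law. *)
pose m := 1 + th.
pose K := expR (- (d%:R * s ^+ 2 / 24) - 2 * th - m).
have K0 : 0 <= K by exact: expR_ge0.
pose p := expR (s / 2); pose q := expR (- (s / 2)).
have le1 : binomial_sum 1 1 d (fun j => expR (s * ((d%:R + 1) / 2 - j%:R)) *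
      (K * (1 + m - s ^+ 2 / (4 * d%:R) * (1 + (d%:R - 2 * j%:R) ^+ 2)))) <=
    binomial_sum 1 1 d (fun j => \prod_(i < d) (1 + (i.+1%:R - j%:R) * h)).
  apply: le_binomial_sum => // j jd.
  have /andP[+ _] := prod_shifted_bounds jd h0 dh erefl erefl; apply: le_trans.
  apply: (@le_trans _ _ (expR (s * ((d%:R + 1) / 2 - j%:R)) * (K * expR (m - y j)))).
    rewrite ler_pM2l ?expR_gt0// ler_pM2l ?expR_gt0//.
    apply: le_trans (expR_ge1Dx _); rewrite -addrA lerD2l lerD2l lerN2 /y.
    have -> : s ^+ 2 / (4 * d%:R) = h ^+ 2 / 2 * d%:R / 2.
      by rewrite /s; field; rewrite pnatr_eq0 -lt0n.
    rewrite mulrA -[leRHS]mulrA; apply: ler_wpM2l.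
      by rewrite !mulr_ge0// invr_ge0.
    (* With u = d - 2j the offset is W = (1 + u)/2, and (1 + u)^2 <= 2 (1 + u^2). *)
    by have := sqr_ge0 (1 - (d%:R - 2 * j%:R) : R); lra.
  (* [m] cancels between [K] and the tangent factor; [K] has d^2 where the product has d^2 - 1,
     which only lowers the bound. *)
  rewrite -!expRD ler_expR -/s -/th /y.
  have -> : d%:R * s ^+ 2 / 24 = h ^+ 2 / 2 * (d%:R * d%:R ^+ 2 / 12).
    by rewrite /s; field.
  have : 0 <= h ^+ 2 / 2 * (d%:R / 12) by rewrite mulr_ge0 ?divr_ge0 ?sqr_ge0.
  by rewrite /th; lra.
rewrite /ratio; apply: le_trans (ler_wpM2l _ le1); last by rewrite exprn_ge0.
rewrite binomial_sum_tilt -/p -/q binomial_sumZ.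
have u0 : 0 <= (p + q) ^+ d by rewrite exprn_ge0// addr_ge0 ?expR_ge0.
(* The tilted mean of the subtracted term is at most [m], so the bracket averages to at least 1. *)
have le2 : (p + q) ^+ d <= binomial_sum p q d (fun j =>
    1 + m - s ^+ 2 / (4 * d%:R) * (1 + (d%:R - 2 * j%:R) ^+ 2)).
  rewrite (eq_binomial_sum _ _ _ (g := fun j => (1 + m - s ^+ 2 / (4 * d%:R)) * 1 +
     (- (s ^+ 2 / (4 * d%:R))) * (d%:R - 2 * j%:R) ^+ 2)); last by move=> j; ring.
  rewrite binomial_sumD !binomial_sumZ binomial_moment0.
  have s01 : 0 <= s <= 2^-1 by rewrite s0.
  have mom := tilted_moment2_le d s01 (erefl p) (erefl q).
  have c0 : 0 <= s ^+ 2 / (4 * d%:R) by rewrite divr_ge0 ?sqr_ge0.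
  have := ler_wpM2l c0 mom; rewrite mulrA.
  have -> : s ^+ 2 / (4 * d%:R) * (d%:R + d%:R ^+ 2 * s ^+ 2) =
     s ^+ 2 / 4 + d%:R * s ^+ 3 * s / 4 by field; rewrite pnatr_eq0 -lt0n.
  rewrite -/th.
  have c1 : s ^+ 2 / (4 * d%:R) <= s ^+ 2 / 4.
    by rewrite ler_pdivrMr ?mulr_gt0// ?ltr0n//; have := sqr_ge0 s; nra.
  have ss : s ^+ 2 <= 4^-1 by nra.
  have ts : th * s <= th by nra.
  have := ler_wpM2r u0 (_ : s ^+ 2 / (4 * d%:R) + (s ^+ 2 / 4 + th * s / 4) <= m).
  rewrite /m => /(_ _); set c := s ^+ 2 / _ in c0 c1 *.
  have h1 : c + (s ^+ 2 / 4 + th * s / 4) <= 1 + th by lra.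
  move/(_ h1); lra.
have := @cosh_ge _ (s / 2); rewrite -/p -/q => ch.
have {}ch : expR ((s / 2) ^+ 2 / 2 - 3 * (s / 2) ^+ 3) <= (p + q) / 2.
  by apply: ch; lra.
(* The losses in [th] are 2 from the logarithms, 1 from [m] and 3/8 from [cosh_ge], below 4 in
   total; the constant 1 comes from [m]. *)
apply: (@le_trans _ _ (p * K * expR ((s / 2) ^+ 2 / 2 - 3 * (s / 2) ^+ 3) ^+ d)).
  rewrite /p -expRM_natl -!expRD ler_expR.
  have -> : d%:R * ((s / 2) ^+ 2 / 2 - 3 * (s / 2) ^+ 3) =
      d%:R * s ^+ 2 / 8 - th * (3 / 8).
    by rewrite /th; field.
  rewrite /m; lra.
apply: (@le_trans _ _ (p * K * ((p + q) / 2) ^+ d)).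
  apply: ler_wpM2l; first by rewrite mulr_ge0 ?expR_ge0.
  by rewrite lerXn2r// nnegrE ?expR_ge0// divr_ge0// addr_ge0 ?expR_ge0.
rewrite (_ : p * K * _ = 2^-1 ^+ d * (p * (K * (p + q) ^+ d))).
  rewrite ler_wpM2l// ler_wpM2l ?expR_ge0// ler_wpM2l//.
by rewrite exprMn; ring.
Qed.

End ratio.

(** * Counting lattice points *)

Definition int_range n : seq int :=
  [seq Posz i | i <- iota 0 n.+1] ++ [seq Negz i | i <- iota 0 n].

Lemma mem_int_range n k : (k \in int_range n) = (absz k <= n)%N.
Proof.
have Pinj : injective Posz by move=> ? ? [].
have Ninj : injective Negz by move=> ? ? [].
rewrite mem_cat; case: k => k.
  rewrite (mem_map Pinj) mem_iota add0n ltnS (_ : (_ \in map Negz _) = false).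
    by rewrite orbF.
  by apply/mapP => -[].
rewrite (mem_map Ninj) mem_iota add0n (_ : (_ \in map Posz _) = false)//.
by apply/mapP => -[].
Qed.

Lemma uniq_int_range n : uniq (int_range n).
Proof.
rewrite cat_uniq !map_inj_uniq ?iota_uniq ?andbT/=; try by move=> ? ? [].
by apply/hasPn => _ /mapP[i _ ->]; apply/mapP => -[].
Qed.

(** Lattice points listed by first coordinate, so that their number obeys a recursion. The truncated
    subtraction is exact because [int_range n] only holds k with |k| <= n. *)
Fixpoint int_ball d n : seq (seq int) :=
  if d is d'.+1 then
    [seq k :: t | k <- int_range n, t <- int_ball d' (n - absz k)%N]
  else [:: [::]].

Lemma mem_int_ball d n t : (t \in int_ball d n) =
  (size t == d) && (\sum_(k <- t) absz k <= n)%N.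
Proof.
elim: d n t => [|d IH] n t.
  by rewrite inE; case: t => //=; rewrite big_nil.
apply/allpairsPdep/andP => [[k [u [+ + ->]]]|].
  rewrite mem_int_range -/(int_ball d _) IH => kn /andP[/eqP <- un].
  by rewrite /= big_cons eqxx -(subnKC kn) leq_add2l.
case: t => [[]|k u]//; rewrite big_cons eqSS => -[/eqP ud un].
have kn : (absz k <= n)%N by exact: leq_trans (leq_addr _ _) un.
exists k, u; split=> //; first by rewrite mem_int_range.
by rewrite -/(int_ball d _) IH leq_subRL// un andbT; apply/eqP.
Qed.

Lemma uniq_int_ball d n : uniq (int_ball d n).
Proof.
elim: d n => [//|d IH] n.
apply: allpairs_uniq_dep => [|k _|]; [exact: uniq_int_range|exact: IH|].
by move=> [k u] [l v] _ _ /= [-> ->].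
Qed.

Lemma size_int_ballS d n : size (int_ball d.+1 n) =
  (\sum_(k < n.+1) size (int_ball d (n - k)) +
   \sum_(k < n) size (int_ball d (n - k.+1)))%N.
Proof.
rewrite [int_ball d.+1 n](erefl
  [seq k :: t | k <- int_range n, t <- int_ball d (n - absz k)%N]).
rewrite size_allpairs_dep map_cat sumn_cat -!map_comp !sumnE !big_map.
rewrite -(big_mkord xpredT (fun k => size (int_ball d (n - k)%N))).
rewrite -(big_mkord xpredT (fun k => size (int_ball d (n - k.+1)%N))).
by rewrite /index_iota !subn0.
Qed.

(** The Delannoy recurrence: at radius n + 1, detaching the first slice of each of the two sums
    leaves the two sums for radius n. *)
Lemma size_int_ballSS d n : size (int_ball d.+1 n.+1) =
  (size (int_ball d n.+1) + size (int_ball d n) + size (int_ball d.+1 n))%N.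
Proof.
rewrite !size_int_ballS big_ord_recl subn0 [in X in (_ + X)%N]big_ord_recl.
rewrite -[LHS]/(size (int_ball d n.+1) + \sum_(k < n.+1) size (int_ball d (n - k)) +
  (size (int_ball d (n - 0)) + \sum_(k < n) size (int_ball d (n - k.+1))))%N.
by rewrite subn0 addnACA addnA.
Qed.

Lemma size_int_ball (R : comNzRingType) d n :
  (size (int_ball d n))%:R =
  binomial_sum 1 1 d (fun j => 'C(n + d - j, d)%:R) :> R.
Proof.
have eqb m (f g : nat -> nat) : (forall j, (j <= m)%N -> f j = g j) ->
    binomial_sum 1 1 m (fun j => (f j)%:R) =
    binomial_sum 1 1 m (fun j => (g j)%:R) :> R.
  by move=> fg; apply: eq_bigr => j _; rewrite fg// -ltnS.
have b0 m : binomial_sum 1 1 m (fun j => 'C(0 + m - j, m)%:R) = 1 :> R.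
  rewrite /binomial_sum big_ord_recl big1 => [|i _].
    by rewrite !bin0 add0n subn0 binn !expr1n !mulr1 addr0.
  rewrite add0n [X in _ * X%:R]bin_small ?mulr0//.
  by rewrite ltn_subrL/= (leq_trans _ (ltn_ord i)).
elim: d n => [|d IHd] n; first by rewrite binomial_sum0 bin0.
elim: n => [|n IHn].
  by rewrite size_int_ballS big_ord0 big_ord1 addn0 subn0 IHd !b0.
rewrite size_int_ballSS !natrD IHn !IHd !binomial_sumS !mul1r.
(* Expanded by [binomial_sumS], the recurrence reads b 1 + b 0 + (c 1 + c 0) = c 2 + c 1, which is
   Pascal's rule [cS] used twice. *)
pose b e := binomial_sum (1 : R) 1 d (fun j => 'C(n + d + e - j, d)%:R).
pose c e := binomial_sum (1 : R) 1 d (fun j => 'C(n + d + e - j, d.+1)%:R).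
have cS e : c e.+1 = c e + b e.
  rewrite -binomial_sumD -(eq_binomial_sum _ _ _ (fun j => natrD _ _ _)).
  by apply: eqb => j jd; rewrite addnS subSn ?binS//; lia.
have bE e f : (forall j, (j <= d)%N -> f j = (n + d + e - j)%N) ->
    binomial_sum 1 1 d (fun j => 'C(f j, d)%:R) = b e.
  by move=> fE; apply: eqb => j /fE ->.
have cE e f : (forall j, (j <= d)%N -> f j = (n + d + e - j)%N) ->
    binomial_sum 1 1 d (fun j => 'C(f j, d.+1)%:R) = c e.
  by move=> fE; apply: eqb => j /fE ->.
rewrite (bE 1%N); last by lia.
rewrite (bE 0%N); last by lia.
rewrite (cE 1%N); last by lia.
rewrite (cE 0%N); last by lia.
rewrite (cE 2%N); last by lia.
by rewrite !cS; ring.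
Qed.

(** Embedding integers into the reals is injective on lists of length d, and coordinatewise floor
    recovers the list from a lattice point. *)
Lemma lattice_countE (R : realType) d n :
  lattice_count R d n = (size (int_ball d n))%:R.
Proof.
pose phi (t : seq int) : d.-tuple (measurableTypeR R) :=
  [tuple ((nth 0 t i)%:~R : R) | i < d].
have phiE t (i : 'I_d) : tnth (phi t) i = (nth 0 t i)%:~R by rewrite tnth_mktuple.
have norm_phi t : size t = d ->
    \sum_(i < d) `|tnth (phi t) i : R| = (\sum_(k <- t) absz k)%N%:R.
  move=> td; rewrite (big_nth 0) td big_mkord natr_sum; apply: eq_bigr => i _.
  by rewrite phiE natr_absz intr_norm.
rewrite /lattice_count; congr _%:R.
have -> : fset_set (@l1_ball R d n `&` @int_lattice R d) =
    [fset x in map phi (int_ball d n)]%fset.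
  apply/fsetP => x; rewrite in_fset_set; last exact: finite_l1_ball_int_lattice.
  rewrite in_fset_ -[RHS]/(x \in map phi (int_ball d n)).
  apply/idP/idP; rewrite inE/=.
    move=> -[xn xint]; apply/mapP.
    pose t := [seq Num.floor (tnth x i : R) | i : 'I_d].
    have td : size t = d by rewrite size_map size_enum_ord.
    have xt : x = phi t.
      apply: eq_from_tnth => i; rewrite phiE /t (nth_map i) ?size_enum_ord//.
      by rewrite nth_ord_enum; apply/esym/eqP; rewrite -intrEfloor; exact: xint.
    exists t => //; rewrite mem_int_ball td eqxx/=.
    by rewrite -(ler_nat R) -norm_phi// -xt.
  move=> /mapP[t]; rewrite mem_int_ball => /andP[/eqP td tn] ->; split.
    by rewrite /l1_ball/= norm_phi// ler_nat.
  by move=> i; rewrite phiE; exact: intr_int.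
rewrite card_fseq undup_id ?size_map// map_inj_in_uniq ?uniq_int_ball//.
move=> t u; rewrite !mem_int_ball => /andP[/eqP td _] /andP[/eqP ud _] tu.
apply: (@eq_from_nth _ 0); first by rewrite td ud.
move=> i; rewrite td => id; apply: (@intr_inj R).
by have := congr1 (fun x => tnth x (Ordinal id)) tu; rewrite !phiE.
Qed.

Lemma size_int_ball_ratio (R : realType) d n : (d <= n)%N -> (0 < n)%N ->
  (size (int_ball d n))%:R = (2 * n%:R) ^+ d / d`!%:R * ratio d (n%:R^-1 : R).
Proof.
move=> dn n0; rewrite size_int_ball /ratio exprMn mulrA.
rewrite (_ : _ * 2^-1 ^+ d = n%:R ^+ d / d`!%:R); last first.
  have := exprMn d (2 : R) 2^-1; rewrite divff// expr1n => two.
  by transitivity ((2 ^+ d * 2^-1 ^+ d) * (n%:R ^+ d / d`!%:R) : R);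
    [ring|rewrite -two mul1r].
rewrite -binomial_sumZ; apply: eq_bigr => j _; congr (_ * _).
have jd : (j <= d)%N by rewrite -ltnS.
apply: (mulIf (_ : d`!%:R != 0)); first by rewrite pnatr_eq0 -lt0n fact_gt0.
(* d! C(n + d - j, d) is a falling factorial; read backwards its factors are n + (i + 1) - j, and
   dividing each by n gives those of [ratio]. *)
rewrite -natrM bin_ffact ffact_prod natr_prod (reindex_inj rev_ord_inj)/=.
rewrite mulrAC divfK ?pnatr_eq0 -?lt0n ?fact_gt0//.
rewrite -[X in n%:R ^+ X]card_ord -prodr_const -big_split/=.
apply: eq_bigr => i _.
have id : (i < d)%N by [].
rewrite (_ : (n + d - j - (d - i.+1) = n + i.+1 - j)%N); last by lia.
rewrite natrB; last by lia.
by rewrite natrD; field; rewrite pnatr_eq0 -lt0n.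
Qed.

(** * The volume *)

Section volume.
Import numFieldNormedType.Exports.
Local Open Scope classical_set_scope.
Local Open Scope ring_scope.
Context {R : realType}.
Notation mu := (@lebesgue_measure R).

Lemma continuous_affine_pow (c e : R) d :
  continuous (fun x : R => (c + e * x) ^+ d).
Proof.
move=> x; apply: (@continuous_comp _ _ _ (fun y => c + e * y) (fun y => y ^+ d)).
  by apply: continuousD; [exact: cvg_cst|exact: mulrl_continuous].
exact: exprn_continuous.
Qed.

Lemma integral_affine_pow (a b c e : R) d : a < b -> e != 0 ->
  (\int[mu]_(x in `[a, b]) ((c + e * x) ^+ d)%:E =
   (((c + e * b) ^+ d.+1 - (c + e * a) ^+ d.+1) / (e * d.+1%:R))%:E)%E.
Proof.
move=> ab e0.
pose F n (x : R) : R := (c + e * x) ^+ n.+1 / (e * n.+1%:R).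
have dF (n : nat) (x : R) : is_derive x 1 (F n) ((c + e * x) ^+ n).
  have -> : F n = ((fun y => c + e * y) ^+ n.+1 * cst (e * n.+1%:R)^-1 : R -> R).
    by apply/funext => y; rewrite /F !fctE.
  apply: is_derive_eq; rewrite /GRing.scale/= ?fctE; field.
  by rewrite e0 addrC natr1 pnatr_eq0.
have cF n : continuous (F n).
  move=> x; apply: differentiable_continuous; apply/derivable1_diffP.
  exact: ex_derive.
rewrite (@continuous_FTC2 R (fun x => (c + e * x) ^+ d) (F d))//.
- by rewrite -EFinB /F mulrBl.
- exact: continuous_subspaceT (@continuous_affine_pow c e d).
- split.
  + by move=> x _; exact: ex_derive.
  + by apply: cvg_at_right_filter; exact: cF.
  + by apply: cvg_at_left_filter; exact: cF.
- by move=> x _; rewrite derive1E derive_val.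
Qed.

(** A real radius is forced by the induction on d: the slice at x has radius r - |x|. *)
Definition real_l1_ball d (r : R) : set (d.-tuple (measurableTypeR R)) :=
  [set x | \sum_(i < d) `|tnth x i : R| <= r].
Arguments real_l1_ball : clear implicits.

(** The inductive step for the volume. The integral is split at 0, since on each half r - |x| is
    affine. *)
Lemma integral_section (r : R) d : 0 <= r ->
  (\int[mu]_(x in `[(- r)%R, r]) ((2 * (r - `|x|)) ^+ d / d`!%:R)%:E =
   ((2 * r) ^+ d.+1 / d.+1`!%:R)%:E)%E.
Proof.
rewrite le_eqVlt => /predU1P[<-|r0].
  by rewrite oppr0 set_itv1 integral_set1 mulr0 expr0n/= mul0r.
have fact0 : d`!%:R != 0 :> R by rewrite pnatr_eq0 -lt0n fact_gt0.
have mf (A : set R) : measurable_fun A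
    (EFin \o (fun x : R => (2 * (r - `|x|)) ^+ d / d`!%:R)).
  apply/measurable_EFinP; apply: measurable_funM => //.
  apply: measurable_funX; apply: measurable_funM => //.
  by apply: measurable_funB => //; apply: measurableT_comp.
have half (a b e : R) : a < b -> e != 0 ->
    (forall x, x \in `[a, b] -> 2 * (r - `|x|) = 2 * r + e * x) ->
    (\int[mu]_(x in `[a, b]) ((2 * (r - `|x|)) ^+ d / d`!%:R)%:E =
     (((2 * r + e * b) ^+ d.+1 - (2 * r + e * a) ^+ d.+1) / (e * d.+1`!%:R))%:E)%E.
  move=> ab e0 xe.
  transitivity (\int[mu]_(x in `[a, b]) ((d`!%:R^-1)%:E * ((2 * r + e * x) ^+ d)%:E))%E.
    apply: eq_integral => x; rewrite inE/= => xab.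
    by rewrite -EFinM mulrC xe.
  rewrite integralZl//; last first.
    apply: continuous_compact_integrable; first exact: segment_compact.
    exact: continuous_subspaceT (@continuous_affine_pow _ _ _).
  rewrite integral_affine_pow// -EFinM; congr EFin.
  by rewrite factS natrM; field; rewrite fact0 e0 addrC natr1 pnatr_eq0.
rewrite (@itv_bndbnd_setU _ _ _ (BRight 0)) ?bnd_simp ?oppr_le0 ?ltW//.
rewrite ge0_integral_setU//=; last 3 first.
- exact: mf.
- move=> x; rewrite !in_itv/= => xr; rewrite lee_fin divr_ge0//.
  rewrite exprn_ge0// mulr_ge0// subr_ge0 ler_norml.
  by case: xr => /andP[xl xu]; apply/andP; split; lra.
- by apply/disj_set2P; apply/seteqP; split => x//=; rewrite !in_itv/=; lra.
rewrite integral_itv_obnd_cbnd; last exact: mf.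
rewrite (half _ _ 2) ?oppr_lt0//; last first.
  by move=> x; rewrite in_itv/= => /andP[_ x0]; rewrite ler0_norm//; ring.
rewrite (half _ _ (-2)) ?oppr_eq0//; last first.
  by move=> x; rewrite in_itv/= => /andP[x0 _]; rewrite ger0_norm//; ring.
rewrite -EFinD; congr EFin.
have -> : 2 * r + 2 * - r = 0 by ring.
have -> : 2 * r + -2 * r = 0 by ring.
by rewrite !mulr0 !addr0 expr0n/=; field; rewrite pnatr_eq0 -lt0n fact_gt0.
Qed.

(** The product measure integrates the measures of the slices, which are balls of radius r - |x|,
    empty when |x| > r. *)
Lemma lebesgue_real_l1_ball d (r : R) : 0 <= r ->
  lebesgue_tuple R d (real_l1_ball d r) = ((2 * r) ^+ d / d`!%:R)%:E.
Proof.
elim: d r => [|d IH] r r0.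
  by rewrite /= diracE mem_set ?/real_l1_ball/= ?big_ord0// expr0 divr1.
rewrite /lebesgue_tuple [LHS]/= /product_measure_cons /pushforward /product_measure1.
rewrite -integral_section// [RHS]integral_mkcond; apply: eq_integral => x _.
rewrite patchE /= -/(lebesgue_tuple R d).
have -> : xsection (@tuple_cons _ (measurableTypeR R) d @^-1` real_l1_ball d.+1 r) x =
    real_l1_ball d (r - `|x|).
  have sum_cons t : \sum_(i < d.+1) `|tnth (tuple_cons (x, t)) i : R| =
      `|x| + \sum_(i < d) `|tnth t i : R|.
    by rewrite big_ord_recl; congr +%R; apply: eq_bigr => i _; rewrite tnthS.
  by apply/seteqP; split=> t; rewrite /xsection/=;
    rewrite /real_l1_ball/= inE/= sum_cons lerBrDl.
case: ifPn; rewrite ?inE ?notin_setE/= in_itv/= -ler_norml => xr.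
  by rewrite IH// subr_ge0.
rewrite (_ : real_l1_ball _ _ = set0) ?measure0//.
apply/seteqP; split=> // t /=; rewrite /real_l1_ball/= => tr.
by apply: xr; rewrite -subr_ge0; apply: le_trans tr; apply: sumr_ge0.
Qed.

Lemma ball_volE d n : ball_vol R d n = (2 * n%:R) ^+ d / d`!%:R.
Proof. by rewrite /ball_vol lebesgue_real_l1_ball. Qed.

End volume.

(** * Comparison *)

(** Splits a quantity of size at most e + 1 into a part bounded by e, to become the O-term, and a
    rest bounded by 1, to become a constant factor. *)
Lemma clamp_near (R : realDomainType) (e x : R) : 0 <= e -> `|x| <= e + 1 ->
  `|Num.max (- e) (Num.min x e)| <= e /\
  `|x - Num.max (- e) (Num.min x e)| <= 1.
Proof.
move=> e0; rewrite ler_norml => /andP[xl xu]; rewrite !ler_norml.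
have [xe|xe] := leP x e; first have [ex|ex] := leP (- e) x.
- by split; lra.
- by split; lra.
- have [ee|ee] := leP (- e) e; by split; lra.
Qed.

Section comparison.
Context {R : realType}.

Definition main_term d n : R := d%:R / (12 * alpha R d n ^+ 2).
Definition error_term d n : R := d%:R / alpha R d n ^+ 3.

Lemma lattice_count_bounds d n : admissible d n ->
  ball_vol R d n * expR (main_term d n - 4 * error_term d n - 1) <=
    lattice_count R d n <=
  ball_vol R d n * expR (main_term d n + 4 * error_term d n + 1).
Proof.
move=> [d0 n0 dn].
have dN : d%:R != 0 :> R by rewrite pnatr_eq0 -lt0n.
have nN : n%:R != 0 :> R by rewrite pnatr_eq0 -lt0n.
rewrite lattice_countE size_int_ball_ratio//; last first.
  by apply: leq_trans dn; rewrite leq_pmull.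
rewrite ball_volE; set V := _ / _.
have V0 : 0 <= V by rewrite divr_ge0// exprn_ge0// mulr_ge0.
have h0 : 0 <= n%:R^-1 :> R by rewrite invr_ge0.
have dh : d%:R * n%:R^-1 <= 2^-1 :> R.
  rewrite ler_pdivrMr ?ltr0n//.
  by have : (2 * d)%:R <= n%:R :> R; [rewrite ler_nat|rewrite natrM; lra].
have -> : main_term d n = d%:R * (d%:R * n%:R^-1) ^+ 2 / 12.
  by rewrite /main_term /alpha; field; rewrite ?dN ?nN.
have -> : error_term d n = d%:R * (d%:R * n%:R^-1) ^+ 3.
  by rewrite /error_term /alpha; field; rewrite ?dN ?nN.
by rewrite !ler_wpM2l ?ratio_ge ?ratio_le.
Qed.

Lemma alpha_gt0 d n : admissible d n -> 0 < alpha R d n.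
Proof. by move=> [d0 n0 _]; rewrite divr_gt0 ?ltr0n. Qed.

Lemma ball_vol_gt0 d n : admissible d n -> 0 < ball_vol R d n.
Proof.
move=> [_ n0 _]; rewrite ball_volE divr_gt0 ?exprn_gt0 ?mulr_gt0 ?ltr0n//.
exact: fact_gt0.
Qed.

Lemma error_term_ge0 d n : admissible d n -> 0 <= error_term d n.
Proof. by move=> /alpha_gt0 a0; rewrite divr_ge0// exprn_ge0// ltW. Qed.

Lemma main_term_ge0 d n : admissible d n -> 0 <= main_term d n.
Proof. by move=> /alpha_gt0 a0; rewrite divr_ge0// mulr_ge0// exprn_ge0// ltW. Qed.

(** Squaring the hypothesis gives a^2 d^3 <= n^2, to be divided by d^2. *)
Lemma le_alpha_sqr d n (a : R) : 0 < a -> admissible d n ->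
  a * d%:R `^ (3 / 2) <= n%:R -> a ^+ 2 * d%:R <= alpha R d n ^+ 2.
Proof.
move=> a0 [d0 n0 _] an.
have dgt : 0 < d%:R :> R by rewrite ltr0n.
rewrite expr_div_n ler_pdivlMr ?exprn_gt0// -mulrA -exprS.
have -> : a ^+ 2 * d%:R ^+ 3 = (a * d%:R `^ (3 / 2)) ^+ 2.
  rewrite exprMn -(powR_mulrn 2 (powR_ge0 _ _)) -powRrM divfK//.
  by rewrite powR_mulrn ?ler0n.
by rewrite lerXn2r// nnegrE ?mulr_ge0 ?powR_ge0// ltW.
Qed.

End comparison.

Theorem corollary1p9 (R : realType) :
  (exists E : nat -> nat -> R,
     uniform_bigO admissible E (fun d n => d%:R / alpha R d n ^+ 3) /\
     uniform_approx admissible (lattice_count R)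
       (fun d n => ball_vol R d n *
          expR (d%:R / (12 * alpha R d n ^+ 2) + E d n))) /\
  (forall a : R, 0 < a ->
     uniform_approx
       (fun d n => admissible d n /\ a * d%:R `^ (3 / 2) <= n%:R)
       (lattice_count R) (ball_vol R)).
Proof.
split.
  (* [L] is the exact exponent beyond the main term. Clamping it to four error terms defines [E];
     what is cut off is at most 1 and costs a factor e. *)
  pose L d n : R := ln (lattice_count R d n / ball_vol R d n) - main_term d n.
  pose E d n : R :=
    Num.max (- (4 * error_term d n)) (Num.min (L d n) (4 * error_term d n)).
  have LE d n : admissible d n -> `|E d n| <= 4 * error_term d n /\
      `|L d n - E d n| <= 1.
    move=> dn; have e0 := @error_term_ge0 R _ _ dn.
    have V0 := @ball_vol_gt0 R _ _ dn.
    have /andP[lo up] := @lattice_count_bounds R _ _ dn.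
    have N0 : 0 < lattice_count R d n.
      by apply: lt_le_trans lo; rewrite mulr_gt0 ?expR_gt0.
    have r0 : 0 < lattice_count R d n / ball_vol R d n by rewrite divr_gt0.
    apply: clamp_near; first by rewrite mulr_ge0.
    have lo' : main_term d n - 4 * error_term d n - 1 <=
        ln (lattice_count R d n / ball_vol R d n).
      by rewrite -ler_expR lnK ?posrE// ler_pdivlMr// mulrC.
    have up' : ln (lattice_count R d n / ball_vol R d n) <=
        main_term d n + 4 * error_term d n + 1.
      by rewrite -ler_expR lnK ?posrE// ler_pdivrMr// mulrC.
    by rewrite /L ler_norml; lra.
  have approx d n : admissible d n ->
      lattice_count R d n =
      ball_vol R d n * expR (main_term d n + E d n) * expR (L d n - E d n).
    move=> dn; have V0 := @ball_vol_gt0 R _ _ dn.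
    have /andP[lo _] := @lattice_count_bounds R _ _ dn.
    have r0 : 0 < lattice_count R d n / ball_vol R d n.
      rewrite divr_gt0//; apply: lt_le_trans lo.
      by rewrite mulr_gt0 ?expR_gt0.
    rewrite -mulrA -expRD (_ : _ + _ + _ = ln (lattice_count R d n / ball_vol R d n)).
      by rewrite lnK ?posrE// mulrC divfK ?gt_eqF.
    by rewrite /L; ring.
  exists E; split; last split.
  - by exists 4 => // d n dn; have [] := LE d n dn.
  - exists (expR 1); first exact: expR_gt0.
    move=> d n dn; rewrite [leLHS]approx// mulrC ler_wpM2r//.
      by rewrite mulr_ge0 ?expR_ge0 ?ltW ?ball_vol_gt0.
    by rewrite ler_expR; have [_] := LE d n dn; rewrite ler_norml => /andP[].
  - exists (expR 1); first exact: expR_gt0.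
    move=> d n dn; rewrite [in leRHS]approx// [leRHS]mulrCA.
    rewrite -[in leRHS]expRD ler_peMr//.
      by rewrite mulr_ge0 ?expR_ge0 ?ltW ?ball_vol_gt0.
    rewrite -[leLHS]expR0 ler_expR.
    by have [_] := LE d n dn; rewrite ler_norml; lra.
(* alpha^2 >= a^2 d bounds the main term by 1/(12 a^2). With d >= 1 it also gives alpha >= a, so
   alpha^3 >= a^3 d and the error term is at most 1/a^3. *)
move=> a a0; pose M := (12 * a ^+ 2)^-1 + 4 * (a ^+ 3)^-1 + 1.
have bounds d n : admissible d n /\ a * d%:R `^ (3 / 2) <= n%:R ->
    ball_vol R d n * expR (- M) <= lattice_count R d n <= ball_vol R d n * expR M.
  move=> [dn an]; have := le_alpha_sqr a0 dn an; have := alpha_gt0 (R := R) dn.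
  have [d0 _ _] := dn; have d1 : 1 <= d%:R :> R by rewrite ler1n.
  have := main_term_ge0 (R := R) dn.
  have /andP[lo up] := @lattice_count_bounds R _ _ dn.
  rewrite /main_term /error_term in lo up *.
  set x := alpha R d n in lo up * => m0 x0 dx.
  have ax : a <= x.
    rewrite -(ler_pXn2r (n := 2)) ?nnegrE ?(ltW a0) ?(ltW x0)//.
    by apply: le_trans dx; rewrite ler_peMr ?sqr_ge0.
  have main_le : d%:R / (12 * x ^+ 2) <= (12 * a ^+ 2)^-1.
    rewrite -[leRHS]mul1r ler_pdivrMr; last by rewrite mulr_gt0// exprn_gt0.
    rewrite mulrAC ler_pdivlMr; last by rewrite mulr_gt0// exprn_gt0.
    by lra.
  have err_le : d%:R / x ^+ 3 <= (a ^+ 3)^-1.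
    rewrite -[leRHS]mul1r ler_pdivrMr ?exprn_gt0// mulrAC ler_pdivlMr ?exprn_gt0//.
    rewrite mul1r [a ^+ 3]exprSr [x ^+ 3]exprSr mulrA ler_pM ?(ltW a0)//.
      by rewrite mulr_ge0// sqr_ge0.
    by rewrite mulrC.
  apply/andP; split.
    by apply: le_trans lo; rewrite ler_pM2l ?ball_vol_gt0// ler_expR /M; lra.
  by apply: le_trans up _; rewrite ler_pM2l ?ball_vol_gt0// ler_expR /M; lra.
split; (exists (expR M); first exact: expR_gt0) => d n /bounds /andP[lo up].
  by rewrite mulrC.
by rewrite mulrC -ler_pdivrMr ?expR_gt0// -expRN.
Qed.
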